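(* Let $\mathbb{F}$ be a field, let $\lambda=(\lambda_1,\ldots,\lambda_m)$ be an $m$-partition of $n$, and let $p\in\mathbb{F}[x_1,\ldots,x_n]$ be a polynomial with $\deg_i(p)=d_i$ for $i=1,\ldots,m$. Assume that there is a monomial $x^{\alpha}$ with $\deg_i(x^{\alpha})=d_i$ for all $i\in\{1,\ldots,m\}$ whose coefficient in $p$ is non-zero. Let $S_i\subset\mathbb{F}^{\lambda_i}$ be finite sets and let $S:=S_1\times S_2\times\cdots\times S_m\subset\mathbb{F}^n$. If $\deg(S_i)>d_i$ for all $i\in\{1,\ldots,m\}$, then there exists $t\in S$ such that $p(t)\neq 0$.
   Context: An $m$-partition of a positive integer $n$ is a tuple $\lambda=(\lambda_1,\ldots,\lambda_m)$ of positive integers with $\sum_i\lambda_i=n$. The variables $x_1,\ldots,x_n$ are split into consecutive blocks according to $\lambda$: $\bar{x}_1=(x_1,\ldots,x_{\lambda_1})$, $\bar{x}_2=(x_{\lambda_1+1},\ldots,x_{\lambda_1+\lambda_2})$, and so on; correspondingly $\mathbb{F}^n=\mathbb{F}^{\lambda_1}\times\cdots\times\mathbb{F}^{\lambda_m}$. $\deg_i(p)$ denotes the (total) degree of $p$ with respect to the variables in the block $\bar{x}_i$. Algebraic degree of a finite set: for a finite set $T\subset\mathbb{F}^{k}$, let $I(T)\subset\mathbb{F}[x_1,\ldots,x_k]$ be the ideal of polynomials vanishing on $T$; then $\deg(T):=\min\{\deg(q): q\in I(T),\ q\neq 0\}$. *)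

(* Defs.v *)
(* Mathematical Components, with multinomials for polynomials. *)
From HB Require Import structures.
From mathcomp Require Import all_boot all_order all_algebra.
From mathcomp Require Import finmap mpoly boolp.

Set Implicit Arguments.
Unset Strict Implicit.
Unset Printing Implicit Defensive.

Import GRing.Theory.
Local Open Scope ring_scope.

Record mpartition (m n : nat) := MPartition {
  blk_size :> 'I_m -> nat;
  blk_gt0 : forall i, (0 < blk_size i)%N;
  blk_sum : (\sum_(i < m) blk_size i)%N = n
}.

Section Blocks.
Variables (m n : nat) (lam : mpartition m n).

(* tagnat.Rank enumerates the blocks consecutively, see block_varE. *)
Definition block_var (i : 'I_m) (j : 'I_(lam i)) : 'I_n :=
  cast_ord (blk_sum lam) (tagnat.Rank i j).

Lemma block_varE (i : 'I_m) (j : 'I_(lam i)) :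
  block_var j = (\sum_(k < m | (k < i)%N) lam k + j)%N :> nat.
Proof. exact: tagnat.RankEsum. Qed.

Definition block_mdeg (i : 'I_m) (a : 'X_{1..n}) : nat :=
  (\sum_(j < lam i) a (block_var j))%N.

(* Equal to 0 on the zero polynomial. *)
Definition block_deg (F : fieldType) (i : 'I_m) (p : {mpoly F[n]}) : nat :=
  \max_(a <- msupp p) block_mdeg i a.

Definition block_proj (F : fieldType) (i : 'I_m) (t : 'rV[F]_n) :
    'rV[F]_(lam i) :=
  \row_(j < lam i) t 0 (block_var j).

Definition block_prod (F : fieldType) (S : forall i, {fset 'rV[F]_(lam i)}) :
    pred 'rV[F]_n :=
  [pred t | [forall i, block_proj i t \in S i]].

End Blocks.

Section AlgebraicDegree.
Variables (F : fieldType) (k : nat).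
Implicit Types (T : {fset 'rV[F]_k}) (q : {mpoly F[k]}).

Definition vanishing_ideal T : {mpoly F[k]} -> Prop :=
  fun q => forall t, t \in T -> q.@[t 0] = 0.

(* msize is one more than the total degree on nonzero polynomials. *)
Definition vanishing_degree T (d : nat) : Prop :=
  exists q, [/\ vanishing_ideal T q, q != 0 & (msize q).-1 = d].

Lemma ex_vanishing_degree T :
  (0 < k)%N -> exists d, `[< vanishing_degree T d >].
Proof.
move=> k_gt0; pose i0 := Ordinal k_gt0.
pose q : {mpoly F[k]} := \prod_(t <- enum_fset T) ('X_i0 - (t 0 i0)%:MP).
exists (msize q).-1; apply/asboolP; exists q; split=> //.
  move=> t tT; rewrite rmorph_prod /=.
  rewrite (big_rem t) //= mevalB mevalXU mevalC subrr mul0r //.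
rewrite prodf_seq_neq0; apply/allP=> t _ /=.
apply/negP=> /eqP /(congr1 (fun r : {mpoly F[k]} => r.@[fun=> t 0 i0 + 1])).
rewrite mevalB mevalXU mevalC meval0 addrC addKr => /eqP.
by rewrite oner_eq0.
Qed.

(* The assumption k > 0 ensures that the minimum is over a nonempty set: for
   k = 0 no nonzero polynomial vanishes on a nonempty T. *)
Definition alg_deg (k_gt0 : (0 < k)%N) T : nat :=
  ex_minn (ex_vanishing_degree T k_gt0).

End AlgebraicDegree.

(* Main.v *)
(* Since no nonzero polynomial of degree at most d_i vanishes on S_i, the
   monomials of degree at most d_i are linearly independent as functions on
   S_i. Hence, for every monomial of degree at most d_i, some weighted sum of
   the values over S_i computes the coefficient of that monomial in any
   polynomial of degree at most d_i. The product of the weights attached to the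
   blocks of alpha is a weight on S whose weighted sum of the values of p is
   the coefficient of alpha in p, so p cannot vanish on all of S. *)
Require Import Defs.
From mathcomp Require Import all_boot all_order all_algebra.
From mathcomp Require Import finmap mpoly boolp.

Set Implicit Arguments.
Unset Strict Implicit.
Unset Printing Implicit Defensive.

Import GRing.Theory.

Local Open Scope ring_scope.

(** The factors range over different types, so each inner sum is first moved to tagged pairs, where
    ordinary distributivity applies; the resulting functions with prescribed tags are the elements
    of [fprod T_]. *)
Lemma bigA_distr_fprod (R : comNzRingType) (I : finType) (T_ : I -> finType)
    (P : forall i, T_ i -> R) :
  \prod_i \sum_(j : T_ i) P i j = \sum_(t : fprod T_) \prod_i P i (t i).
Proof.
pose P' i := [ffun j : T_ i => P i j].
transitivity (\prod_i \sum_(j : T_ i) P' i j).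
  by apply: eq_bigr => i _; apply: eq_bigr => j _; rewrite ffunE.
transitivity (\sum_(t : fprod T_) \prod_i P' i (t i)); last first.
  by apply: eq_bigr => t _; apply: eq_bigr => i _; rewrite ffunE.
under eq_bigr do rewrite (big_tag P').
by rewrite bigA_distr_big_dep; apply/esym/big_fprod.
Qed.

Lemma block_var_bij (m n : nat) (lam : mpartition m n) :
  bijective (fun u : {i & 'I_(lam i)} => block_var (tagged u)).
Proof.
exists (fun k => tagnat.sig (cast_ord (esym (blk_sum lam)) k)) => [[i j]|k] /=.
  by rewrite cast_ordK tagnat.rankK.
by rewrite /block_var tagnat.sig2K cast_ordKV.
Qed.

Lemma prod_block_var (R : comNzRingType) (m n : nat) (lam : mpartition m n)
    (f : 'I_n -> R) :
  \prod_k f k = \prod_i \prod_(j < lam i) f (block_var j).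
Proof.
by rewrite sig_big_dep (reindex _ (onW_bij _ (block_var_bij lam))).
Qed.

Section CoefficientFunctional.
Variables (F : fieldType) (k d : nat) (T : {fset 'rV[F]_k}).
Hypothesis vanish0 :
  forall q, vanishing_ideal T q -> (msize q <= d.+1)%N -> q = 0.

(** A linear dependence between the rows is the coefficient vector of a polynomial of degree at most
    [d] vanishing on [T], which [vanish0] forces to be zero. *)
Lemma row_free_mnm_eval :
  row_free (\matrix_(a < #|{: 'X_{1..k < d.+1}}|, t < #|{: T}|)
    \prod_j val (enum_val t) 0 j ^+ (enum_val a : 'X_{1..k}) j).
Proof.
apply: inj_row_free => v /rowP vA0.
pose q := \sum_a v 0 a *: 'X_[F, (enum_val a : 'X_{1..k < d.+1})].
have q0 : q = 0.
  apply: vanish0 => [t tT|].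
    have := vA0 (enum_rank [` tT]%fset); rewrite !mxE => <-.
    rewrite raddf_sum /=; apply: eq_bigr => a _.
    by rewrite mevalZ mevalX mxE enum_rankK.
  apply: (leq_trans (msize_sum _ _ _)); apply/bigmax_leqP => a _.
  apply: (leq_trans (msizeZ_le _ _)); rewrite msizeX.
  exact: bmdeg.
apply/rowP=> a; rewrite mxE -[RHS](mcoeff0 F (enum_val a)) -q0 raddf_sum /=.
rewrite (bigD1 a) //= mcoeffZ mcoeffX eqxx mulr1 big1 ?addr0 // => b ba.
by rewrite mcoeffZ mcoeffX val_eqE (inj_eq enum_val_inj) (negPf ba) mulr0.
Qed.

(** The weights are the column indexed by [alpha] of a right inverse of the evaluation matrix. *)
Lemma ex_coef_functional (alpha : 'X_{1..k}) : (mdeg alpha <= d)%N ->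
  exists w : T -> F, forall beta : 'X_{1..k}, (mdeg beta <= d)%N ->
    \sum_(t : T) w t * \prod_j val t 0 j ^+ beta j = (beta == alpha)%:R.
Proof.
move=> ale; have /row_freeP[B AB] := row_free_mnm_eval.
pose rk (c : 'X_{1..k}) (cle : (mdeg c <= d)%N) :=
  enum_rank (BMultinom (cle : (mdeg c < d.+1)%N)).
exists (fun t => B (enum_rank t) (rk _ ale)) => beta ble.
have /matrixP/(_ (rk _ ble) (rk _ ale)) := AB.
rewrite !mxE (inj_eq enum_rank_inj) -val_eqE /= => <-.
rewrite [RHS](reindex (@enum_rank T)) /=; last exact/onW_bij/enum_rank_bij.
by apply: eq_bigr => t _; rewrite mxE !enum_rankK mulrC.
Qed.

End CoefficientFunctional.

Lemma vanishing_ideal_lt_alg_deg (F : fieldType) (k : nat) (k_gt0 : (0 < k)%N)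
    (T : {fset 'rV[F]_k}) (d : nat) (q : {mpoly F[k]}) :
  (d < alg_deg k_gt0 T)%N -> vanishing_ideal T q -> (msize q <= d.+1)%N ->
  q = 0.
Proof.
rewrite /alg_deg; case: ex_minnP => e _ emin de qT qle.
apply/eqP; apply: contraLR de => q0; rewrite -leqNgt.
apply: leq_trans (emin (msize q).-1 _) _; first by apply/asboolP; exists q.
by case: (msize q) qle.
Qed.

Theorem theorem1p4 (F : fieldType) (m n : nat) (n_gt0 : (0 < n)%N)
    (lam : mpartition m n) (p : {mpoly F[n]}) (d : 'I_m -> nat)
    (p_deg : forall i, block_deg lam i p = d i)
    (p_mon : exists alpha : 'X_{1..n},
        (forall i, block_mdeg lam i alpha = d i) /\ p@_alpha != 0)
    (S : forall i, {fset 'rV[F]_(lam i)})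
    (S_deg : forall i, (d i < alg_deg (blk_gt0 lam i) (S i))%N) :
  exists2 t : 'rV[F]_n, t \in block_prod S & p.@[t 0] != 0.
Proof.
case: p_mon => alpha [alpha_deg alpha_p].
pose blk i (a : 'X_{1..n}) := [multinom a (block_var j) | j < lam i].
have mdeg_blk i a : mdeg (blk i a) = block_mdeg lam i a.
  by rewrite mdegE; apply: eq_bigr => j _; rewrite mnmE.
have [w wP] : exists w : forall i, S i -> F, forall i (beta : 'X_{1..lam i}),
    (mdeg beta <= d i)%N ->
    \sum_(t : S i) w i t * \prod_j val t 0 j ^+ beta j
      = (beta == blk i alpha)%:R.
  have ex i := ex_coef_functional
    (fun q => vanishing_ideal_lt_alg_deg (S_deg i))
    (eq_leq (etrans (mdeg_blk i alpha) (alpha_deg i))).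
  by exists (fun i => projT1 (cid (ex i))) => i; exact: projT2 (cid (ex i)).
(* Glues one point from each [S i] into a vector of length [n]; these vectors lie in
   [block_prod S]. *)
pose pt (t : fprod (fun i => S i : finType)) : 'rV[F]_n :=
  \row_k let u := tagnat.sig (cast_ord (esym (blk_sum lam)) k) in
    val (t (tag u)) 0 (tagged u).
have ptE t i (j : 'I_(lam i)) : pt t 0 (block_var j) = val (t i) 0 j.
  by rewrite mxE cast_ordK /tagnat.Rank tagnat.rankK.
have sumE : \sum_(t : fprod (fun i => S i : finType))
    (\prod_i w i (t i)) * p.@[pt t 0] = p@_alpha.
  under eq_bigr do rewrite mevalE mulr_sumr.
  rewrite exchange_big /=.
  transitivity (\sum_(b <- msupp p) p@_b * (b == alpha)%:R); last first.
    rewrite (bigD1_seq alpha) ?mcoeff_msupp //= eqxx mulr1 big1 ?addr0 //.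
    by move=> b /negPf->; rewrite mulr0.
  rewrite big_seq [RHS]big_seq; apply: eq_bigr => b bp.
  (* Both the weight and the monomial factor over the blocks, so the sum over the grid becomes a
     product of block sums, each evaluated by [wP]. *)
  under eq_bigr do rewrite mulrCA (prod_block_var lam) -big_split /=.
  rewrite -mulr_sumr; congr (_ * _).
  pose G i (s : S i) := w i s * \prod_j val s 0 j ^+ blk i b j.
  transitivity (\prod_i \sum_s G i s).
    rewrite bigA_distr_fprod; apply: eq_bigr => t _; apply: eq_bigr => i _.
    by congr (_ * _); apply: eq_bigr => j _; rewrite ptE mnmE.
  have -> : \prod_i \sum_s G i s = \prod_i (blk i b == blk i alpha)%:R.
    apply: eq_bigr => i _; apply: wP.
    (* [wP] applies because [b] is in the support of [p], so its degree in block [i] is at most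
       [d i]. *)
    by rewrite mdeg_blk -p_deg; apply: leq_bigmax_seq.
  have [->|b_neq] := eqVneq b alpha.
    by rewrite big1 // => i _; rewrite eqxx.
  (* A nonzero product makes [b] and [alpha] agree on every block, and every variable lies in some
     block. *)
  apply/eqP; apply: contraNT b_neq => /prodf_neq0 neq; apply/eqP/mnmP => x.
  have [g _ gK] := block_var_bij lam; rewrite -(gK x).
  have := neq (tag (g x)) isT; case: (eqVneq (blk _ b)) => [blkE _|_].
    by have /mnmP/(_ (tagged (g x))) := blkE; rewrite !mnmE.
  by rewrite eqxx.
have [/existsP[t pt0]|] := boolP [exists t, p.@[pt t 0] != 0].
  exists (pt t) => //; apply/forallP => i.
  have -> : block_proj lam i (pt t) = val (t i).
    by apply/rowP => j; rewrite mxE ptE.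
  exact: valP.
move=> /existsPn p0; case/eqP: alpha_p; rewrite -sumE big1 // => t _.
by have /negPn/eqP-> := p0 t; rewrite mulr0.
Qed.
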